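(* Let $A,B,C\in M_n(\mathbb{C})$ be such that $0\leq A\leq B\leq C$, and let $D=A+C-B$. Then $$\det A\,\det C\leq\det B\,\det D.$$
   Context: For self-adjoint matrices, $A\leq B$ means $B-A$ is positive semidefinite; in particular $0\le A$ means $A$ is positive semidefinite. *)

(* Defs.v *)
From mathcomp Require Import all_boot all_order all_algebra.
From mathcomp Require Import spectral.
From mathcomp Require Import complex.
From mathcomp Require Import reals.

Set Implicit Arguments.
Unset Strict Implicit.
Unset Printing Implicit Defensive.

Import Order.TTheory GRing.Theory Num.Theory.
Local Open Scope ring_scope.
Local Open Scope sesquilinear_scope.

(* In a numClosedFieldType, [0 <= z] means that z is real and nonnegative. *)
Definition psdmx (K : numClosedFieldType) (n : nat) (A : 'M[K]_n) : Prop :=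
  A \is hermsymmx /\ forall x : 'cV[K]_n, 0 <= (x^t* *m A *m x) 0 0.

Definition loewner_le (K : numClosedFieldType) (n : nat) (A B : 'M[K]_n) : Prop :=
  psdmx (B - A).

(* Main.v *)
(* If det A = 0, the right-hand side is a product of nonnegative determinants.
   Otherwise write B - A = S S^t*. By the determinant lemma
   det (M + S S^t* ) = det M det (1 + S^t* M^-1 S), applied to M = A (giving B)
   and to M = D (giving C), the claim reduces to
   det (1 + S^t* D^-1 S) <= det (1 + S^t* A^-1 S), which holds since A <= D
   implies D^-1 <= A^-1 and det is monotone on the positive cone. *)
Require Import Defs.
From mathcomp Require Import all_boot all_order all_algebra.
From mathcomp Require Import spectral.
From mathcomp Require Import complex reals.

Import Order.TTheory GRing.Theory Num.Theory.
Local Open Scope ring_scope.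
Local Open Scope sesquilinear_scope.

Lemma trmxC_mul {K : numClosedFieldType} {m n p : nat}
  (A : 'M[K]_(m, n)) (B : 'M[K]_(n, p)) : (A *m B)^t* = B^t* *m A^t*.
Proof. by rewrite trmx_mul map_mxM. Qed.

Lemma hermsymmxP {K : numClosedFieldType} {n : nat} {A : 'M[K]_n} :
  reflect (A^t* = A) (A \is hermsymmx).
Proof.
rewrite is_hermitianmxE expr0 scale1r eq_sym.
exact: eqP.
Qed.

Lemma hermsymmx_inv {K : numClosedFieldType} {n : nat} {A : 'M[K]_n} :
  A \is hermsymmx -> invmx A \is hermsymmx.
Proof. by move=> /hermsymmxP hA; apply/hermsymmxP; rewrite trmx_inv map_invmx hA. Qed.

Lemma psdmxD {K : numClosedFieldType} {n : nat} {A B : 'M[K]_n} :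
  psdmx A -> psdmx B -> psdmx (A + B).
Proof.
move=> [/hermsymmxP hA pA] [/hermsymmxP hB pB]; split=> [|x].
  by apply/hermsymmxP; rewrite linearD map_mxD hA hB.
by rewrite mulmxDr mulmxDl mxE addr_ge0.
Qed.

Lemma psdmx_congr {K : numClosedFieldType} {m n : nat} {A : 'M[K]_n}
  (S : 'M[K]_(n, m)) : psdmx A -> psdmx (S^t* *m A *m S).
Proof.
move=> [/hermsymmxP hA pA]; split=> [|x].
  by apply/hermsymmxP; rewrite !trmxC_mul trmxCK hA mulmxA.
by have := pA (S *m x); rewrite trmxC_mul !mulmxA.
Qed.

Lemma psdmx1 {K : numClosedFieldType} {n : nat} : psdmx (1%:M : 'M[K]_n).
Proof.
split=> [|x]; first by apply/hermsymmxP; rewrite trmx1 map_mx1.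
rewrite mulmx1 mxE sumr_ge0 // => i _.
by rewrite !mxE mulrC mul_conjC_ge0.
Qed.

(** Since [invmx A] is Hermitian, it equals its own congruence [(invmx A)^t* *m A *m invmx A] of
    [A]. *)
Lemma psdmx_inv {K : numClosedFieldType} {n : nat} {A : 'M[K]_n} :
  A \in unitmx -> psdmx A -> psdmx (invmx A).
Proof.
move=> uA pA; have /hermsymmxP hV := hermsymmx_inv (proj1 pA).
by have := psdmx_congr (invmx A) pA; rewrite hV mulVmx // mul1mx.
Qed.

Lemma psdmx_spectral {K : numClosedFieldType} {n : nat} {A : 'M[K]_n} :
  psdmx A -> exists (P : 'M[K]_n) (d : 'rV[K]_n),
    [/\ P^t* *m P = 1%:M, forall i, 0 <= d 0 i & A = P^t* *m diag_mx d *m P].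
Proof.
move=> [hA pA]; have /orthomx_spectralP := hermitian_normalmx hA.
set P := spectralmx A; set d := spectral_diag A => eA.
have uP : P \is unitarymx := spectral_unitarymx A.
rewrite (invmx_unitary uP) in eA.
exists P, d; split=> //.
  by rewrite -(invmx_unitary uP) mulVmx // unitarymx_unit.
(* The vector [P^t* *m e] is the [i]-th eigenvector, so the quadratic form of [A] there is the
   eigenvalue [d 0 i]. *)
move=> i; set e : 'cV[K]_n := delta_mx i 0; have := pA (P^t* *m e).
have -> : (P^t* *m e)^t* *m A *m (P^t* *m e) = e^t* *m diag_mx d *m e.
  by rewrite eA trmxC_mul trmxCK !mulmxA !(mulmxtVK _ uP).
by rewrite /e trmx_delta map_delta_mx -rowE -colE !mxE eqxx mulr1n.
Qed.

(** Split the diagonal of the spectral decomposition into two equal square roots, which are real and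
    hence fixed by conjugation. *)
Lemma psdmx_factor {K : numClosedFieldType} {n : nat} {A : 'M[K]_n} :
  psdmx A -> exists S : 'M[K]_n, A = S *m S^t*.
Proof.
move=> /psdmx_spectral[P [d [_ d0 ->]]].
pose r := \row_i sqrtC (d 0 i).
exists (P^t* *m diag_mx r); rewrite trmxC_mul trmxCK !mulmxA; congr (_ *m P).
rewrite -mulmxA tr_diag_mx map_diag_mx mulmx_diag; congr (_ *m diag_mx _).
apply/rowP=> i; have r0 : 0 <= sqrtC (d 0 i) by rewrite sqrtC_ge0.
by rewrite !mxE /= (geC0_conj r0) -expr2 sqrtCK.
Qed.

Lemma psdmx_det_ge0 {K : numClosedFieldType} {n : nat} {A : 'M[K]_n} :
  psdmx A -> 0 <= \det A.
Proof.
move=> /psdmx_factor[S ->].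
by rewrite det_mulmx det_map_mx det_tr mul_conjC_ge0.
Qed.

(** The identity is absorbed into the spectral decomposition, so the determinant is the product of
    the [1 + d 0 i], each at least 1. *)
Lemma psdmx_det1D_ge1 {K : numClosedFieldType} {n : nat} {A : 'M[K]_n} :
  psdmx A -> 1 <= \det (1%:M + A).
Proof.
move=> /psdmx_spectral[P [d [PP d0 ->]]].
have -> : 1%:M + P^t* *m diag_mx d *m P
          = P^t* *m diag_mx (const_mx 1 + d) *m P.
  by rewrite linearD /= diag_const_mx mulmxDr mulmxDl mulmx1 PP.
rewrite !det_mulmx mulrAC -det_mulmx PP det1 mul1r det_diag.
apply: (big_ind (fun x : K => 1 <= x)) => // [x y|i _]; first exact: mulr_ege1.
by rewrite !mxE lerDl.
Qed.

(** Sylvester's identity: two block matrices of determinant computable by blocks are multiplied in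
    both orders. Both products are block lower triangular, and they have the same determinant. *)
Lemma det_1D_mulmxC {K : comNzRingType} {m n : nat}
  (U : 'M[K]_(m, n)) (V : 'M[K]_(n, m)) :
  \det (1%:M + U *m V) = \det (1%:M + V *m U).
Proof.
have e1 : block_mx 1%:M (- U) V 1%:M *m block_mx 1%:M U 0 1%:M
          = block_mx 1%:M 0 V (1%:M + V *m U).
  by rewrite mulmx_block !mulmx1 !mulmx0 mul1mx !addr0 subrr addrC.
have e2 : block_mx 1%:M U 0 1%:M *m block_mx 1%:M (- U) V 1%:M
          = block_mx (1%:M + U *m V) 0 V 1%:M.
  by rewrite mulmx_block !mulmx1 !mul1mx !mul0mx !add0r addNr.
have := congr1 determinant e1; have := congr1 determinant e2.
by rewrite !det_mulmx !det_ublock !det_lblock !det1 !mul1r !mulr1 => <- <-.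
Qed.

(** Factor [M + S *m T] as [M *m (1%:M + invmx M *m S *m T)] and move [T] to the front by
    Sylvester's identity. *)
Lemma detD_mulmx {K : fieldType} {n : nat} {M : 'M[K]_n} (S T : 'M[K]_n) :
  M \in unitmx -> \det (M + S *m T) = \det M * \det (1%:M + T *m invmx M *m S).
Proof.
move=> uM; rewrite -mulmxA -det_1D_mulmxC -det_mulmx mulmxDr mulmx1.
by rewrite -mulmxA mulKVmx.
Qed.

(** For invertible [A], writing [B - A = S *m S^t*] makes [\det B] equal to [\det A] times
    [\det (1%:M + S^t* *m invmx A *m S)], a factor at least 1. For singular [A] it suffices that
    [\det B] is nonnegative. *)
Lemma ler_det {K : numClosedFieldType} {n : nat} {A B : 'M[K]_n} :
  psdmx A -> loewner_le A B -> \det A <= \det B.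
Proof.
move=> pA pBA; have eB : B = A + (B - A) by rewrite addrC subrK.
have [uA|] := boolP (A \in unitmx); last first.
  rewrite unitmxE unitfE negbK => /eqP->.
  by apply: psdmx_det_ge0; rewrite eB; apply: psdmxD.
have [S eS] := psdmx_factor pBA.
rewrite eB eS detD_mulmx // ler_peMr ?psdmx_det_ge0 // psdmx_det1D_ge1 //.
by have := psdmx_congr S (psdmx_inv uA pA).
Qed.

Lemma loewner_le_inv {K : numClosedFieldType} {n : nat} {A B : 'M[K]_n} :
  A \in unitmx -> B \in unitmx -> psdmx A -> loewner_le A B ->
  loewner_le (invmx B) (invmx A).
Proof.
move=> uA uB pA pBA.
have hA : A^t* = A by apply/hermsymmxP; case: pA.
have hB : B^t* = B.
  have [/hermsymmxP] := pBA; rewrite linearB /= map_mxB hA => /(congr1 (+%R^~ A)).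
  by rewrite !subrK.
have hVA : (invmx A)^t* = invmx A by rewrite trmx_inv map_invmx hA.
have hVB : (invmx B)^t* = invmx B by rewrite trmx_inv map_invmx hB.
have hV : (invmx A - invmx B)^t* = invmx A - invmx B.
  by rewrite linearB /= map_mxB hVA hVB.
(* A^-1 - B^-1 = (A^-1 - B^-1) A (A^-1 - B^-1) + B^-1 (B - A) B^-1 *)
have := psdmxD (psdmx_congr (invmx A - invmx B) pA) (psdmx_congr (invmx B) pBA).
rewrite hV hVB /loewner_le; congr psdmx.
rewrite !(mulmxBl, mulmxBr) (mulVmx uA) (mulVmx uB) !mul1mx (mulmxK uA).
by rewrite subrK.
Qed.

Lemma loewner_le_det_mul {K : numClosedFieldType} {n : nat} {A B C D : 'M[K]_n}
  (hA : loewner_le 0 A) (hAB : loewner_le A B) (hBC : loewner_le B C)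
  (hD : D = A + C - B) :
  \det A * \det C <= \det B * \det D.
Proof.
have pA : psdmx A by move: hA; rewrite /loewner_le subr0.
have eB : B = A + (B - A) by rewrite addrC subrK.
(* This turns [B <= C] into [A <= D], the comparison that drives the proof. *)
have eD : D - A = C - B by rewrite hD addrAC [A + C]addrC addrK.
have AD : loewner_le A D by rewrite /loewner_le eD.
have dD : \det A <= \det D := ler_det pA AD.
have [uA|] := boolP (A \in unitmx); last first.
  rewrite unitmxE unitfE negbK => /eqP dA0; rewrite dA0 in dD *.
  by rewrite mul0r mulr_ge0 // -dA0 ler_det.
have dA : 0 < \det A.
  by rewrite lt_def psdmx_det_ge0 // -unitfE -unitmxE uA.
have uD : D \in unitmx by rewrite unitmxE unitfE gt_eqF // (lt_le_trans dA).
have pD : psdmx D by rewrite -(subrK A D) eD; apply: psdmxD.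
have [S eS] := psdmx_factor hAB.
have -> : C = D + S *m S^t* by rewrite -eS hD addrA subrK addrAC subrr add0r.
(* Both sides now contain [\det A * \det D]; cancelling [\det A > 0] leaves the common factor
   [\det D >= 0]. *)
rewrite [in leRHS]eB eS (detD_mulmx _ _ uD) (detD_mulmx _ _ uA) -mulrA ler_pM2l // mulrC.
apply: ler_wpM2r; first exact: psdmx_det_ge0.
apply: ler_det.
  by apply: psdmxD; [exact: psdmx1 | exact: psdmx_congr S (psdmx_inv uD pD)].
(* The identities cancel, and the difference is the congruence by [S] of [invmx A - invmx D]. *)
rewrite /loewner_le opprD addrACA subrr add0r -mulmxBl -mulmxBr.
exact: psdmx_congr S (loewner_le_inv uA uD pA AD).
Qed.

(* In R[i], [x <= y] means that y - x is real and nonnegative. *)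
Theorem corollary1p4 (R : realType) (n : nat) (A B C D : 'M[R[i]]_n)
  (hA : loewner_le 0 A) (hAB : loewner_le A B) (hBC : loewner_le B C)
  (hD : D = A + C - B) :
  \det A * \det C <= \det B * \det D.
Proof. exact: loewner_le_det_mul hA hAB hBC hD. Qed.
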